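(* For every $\varepsilon > 0$ there is a real $\sigma \geq 1$ such that there is no online algorithm for the $\sigma$-interval coloring problem with asymptotic competitive ratio $5/2 - \varepsilon$.
   Context: For a real $\sigma \ge 1$, the $\sigma$-interval coloring problem is: given a sequence of closed real intervals $[l_1,r_1],\ldots,[l_n,r_n]$ with $1 \le r_i-l_i \le \sigma$ for every $i$, find colors $c_1,\ldots,c_n$ such that for all $i\neq j$, $[l_i,r_i]\cap[l_j,r_j]\neq\emptyset$ implies $c_i\neq c_j$, minimizing the number of distinct colors used. In the online setting the intervals are presented one by one, in an arbitrary order (as intervals, i.e. with their endpoints), and a deterministic algorithm must assign a color to each interval immediately and irrevocably when it is presented, without knowledge of later intervals; $\sigma$ is a fixed parameter of the problem. A set (or sequence, with repetitions allowed) of intervals is $\chi$-colorable if its intersection graph can be properly colored (offline) with at most $\chi$ colors. For an online algorithm $A$, $A(\chi)$ denotes the maximum number of colors $A$ uses on any input that is $\chi$-colorable. $A$ has asymptotic competitive ratio $\alpha$ (is $\alpha$-competitive) if $\limsup_{\chi\to\infty} A(\chi)/\chi \le \alpha$. *)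

(* Defs.v *)
From HB Require Import structures.
From mathcomp Require Import all_boot all_order all_algebra.
From mathcomp Require Import all_classical all_reals all_analysis.

Set Implicit Arguments.
Unset Strict Implicit.
Unset Printing Implicit Defensive.

Import Order.TTheory GRing.Theory Num.Theory.
Import numFieldNormedType.Exports.

Local Open Scope classical_set_scope.
Local Open Scope ring_scope.

(* The pair (l, r) encodes the closed interval [l, r]; an input is a finite
   sequence of such pairs in order of presentation, repetitions allowed. *)
Definition sigma_input (R : realType) (sigma : R) (s : seq (R * R)) : Prop :=
  forall I, I \in s -> 1 <= I.2 - I.1 <= sigma.

Definition intersecting (R : realType) (I J : R * R) : Prop :=
  [set` `[I.1, I.2]] `&` [set` `[J.1, J.2]] !=set0.

Definition proper_coloring (R : realType) (s : seq (R * R)) (c : seq nat) :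
    Prop :=
  size c = size s /\
  forall i j : nat, (i < size s)%N -> (j < size s)%N -> i <> j ->
    intersecting (nth (0, 0) s i) (nth (0, 0) s j) -> nth 0%N c i <> nth 0%N c j.

Definition num_colors (c : seq nat) : nat := size (undup c).

Definition colorable (R : realType) (chi : nat) (s : seq (R * R)) : Prop :=
  exists c : seq nat, proper_coloring s c /\ (num_colors c <= chi)%N.

(* [A past I] is the color given to the interval I presented after the
   sequence [past]. The colors already assigned need not be an argument: A is
   deterministic, so they are determined by [past]. *)
Definition strategy (R : realType) : Type := seq (R * R) -> R * R -> nat.

Definition run (R : realType) (A : strategy R) (s : seq (R * R)) : seq nat :=
  mkseq (fun i => A (take i s) (nth (0, 0) s i)) (size s).

Definition online_algorithm (R : realType) (sigma : R) (A : strategy R) :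
    Prop :=
  forall s : seq (R * R), sigma_input sigma s -> proper_coloring s (run A s).

(* The maximum A(chi) is taken as a supremum in the extended reals: it is +oo
   when the number of colors used on chi-colorable inputs is unbounded. *)
Definition max_colors (R : realType) (sigma : R) (A : strategy R)
    (chi : nat) : \bar R :=
  ereal_sup [set (num_colors (run A s))%:R%:E | s in
    [set s : seq (R * R) | sigma_input sigma s /\ colorable chi s]].

(* The term at chi = 0 is a junk value, irrelevant to the limit superior. *)
Definition competitive (R : realType) (sigma : R) (A : strategy R)
    (alpha : R) : Prop :=
  (limn_esup (fun chi : nat => max_colors sigma A chi * (chi%:R^-1)%:E) <=
   alpha%:E)%E.

(* Main.v *)
Require Import Defs.
From HB Require Import structures.
From mathcomp Require Import all_boot all_order all_algebra.
From mathcomp Require Import all_classical all_reals all_analysis.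
From mathcomp Require Import zify ring lra.

(** Fix an online algorithm. The adversary plays inside a window of bounded
    width and forces many colors there while the intervals it presents stay
    colorable offline with few colors. Suppose that, wherever and after whatever
    history, it can force c colors in a window of width W at the price of m
    offline colors. The core of the proof is that, for d <= m, it can then force
    about c + 5d/2 colors at the price of m + d, in a window whose width depends
    on W but not on m, d and c. Iterating, the ratio of forced to offline colors
    tends to 5/2, and the lengths stay bounded by the width of the last window,
    which depends on the number of iterations and not on the number of colors:
    this bound provides the required sigma.

    The step plays the strategy for c four times, in four adjacent cells, with
    color sets A_1, ..., A_4. Let e be a small fraction of d.

    If the union of the A_i has at least c + e colors, the four cells together
    form a window with e more colors at no offline cost; the same is tried again
    from there. After about 5d/(2e) successful trials the desired number of
    colors is reached without having used the d additional offline colors.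

    Otherwise the union U of the A_i has fewer than c + e colors, so each A_i is
    almost all of U, and a new interval that covers cell i, hence avoids A_i,
    can have only few colors of U: the four cells behave as if they had the same
    color set ([count_avoiding]). The adversary covers the first cell with d
    copies of one interval, getting a color set p, and the fourth cell with d
    copies of another one, getting q. Let x be the size of their intersection.
    - If x <= d/2, it presents d copies of an interval that covers the two
      middle cells and touches both previous intervals: their color set r is
      disjoint from p and q, and the union has 3d - x >= 5d/2 colors
      ([gain_wide]).
    - If x > d/2, it covers the second cell with d copies touching the first
      interval, with color set r, and the third cell with d copies touching that
      interval and the fourth cell's, with color set v. Now r avoids p, while v
      avoids q and r, so r, v and the common part of p and q are disjoint: this
      gives 2d + x >= 5d/2 colors ([gain_narrow]).
    Up to 3e of these colors may belong to U. Adjacent covering intervals meet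
    only at the boundary of cells, where nothing else is present, so an offline
    coloring lets them use the d lowest and the d highest of the m + d colors
    alternately ([packed_wide], [packed_narrow]).

    With N iterations, d = 2Nu and e = u for an arbitrary u, the adversary forces
    N(5N-3)u colors on an input that is 2N(N+1)u-colorable. The ratio
    (5N-3)/(2(N+1)) exceeds 5/2 - eps for large N, and it is attained for
    arbitrarily large numbers of offline colors by letting u grow. *)

Set Implicit Arguments.
Unset Strict Implicit.
Unset Printing Implicit Defensive.

Import Order.TTheory GRing.Theory Num.Theory.
Import numFieldNormedType.Exports.

Local Open Scope classical_set_scope.
Local Open Scope ring_scope.

(** * Counting colors *)

Section Counting.
Local Open Scope nat_scope.
Implicit Types A U V p q r v : seq nat.

Lemma num_colors_sub U V : {subset U <= V} -> num_colors U <= num_colors V.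
Proof.
by move=> UV; apply: uniq_leq_size (undup_uniq _) _ => x; rewrite !mem_undup => /UV.
Qed.

(** A set of at least [c] colors misses at most [e] of the at most [c + e] colors
    around it, so avoiding [A] is almost the same as avoiding all of [U]. *)
Lemma count_avoiding A U v c e : {subset A <= U} -> c <= num_colors A ->
  num_colors U <= c + e -> uniq v -> {in A, forall x, x \notin v} ->
  count (mem U) v <= e.
Proof.
move=> AU cA Uce uv Av.
suff: num_colors A + count (mem U) v <= num_colors U by lia.
rewrite -size_filter -size_cat; apply: uniq_leq_size => [|x].
  rewrite cat_uniq undup_uniq filter_uniq // andbT /=.
  apply/hasPn => x; rewrite mem_filter mem_undup => /andP[_ xv].
  by apply: contraTN xv => /Av.
by rewrite mem_cat !mem_undup mem_filter => /orP[/AU //|/andP[]].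
Qed.

Lemma num_colors_new U V v e : uniq v -> {subset v <= V} ->
  count (mem U) v <= e -> num_colors U + size v <= num_colors (U ++ V) + e.
Proof.
move=> uv vV Ue; rewrite -(count_predC (mem U) v).
suff: num_colors U + count (predC (mem U)) v <= num_colors (U ++ V) by lia.
rewrite -size_filter -size_cat; apply: uniq_leq_size => [|x].
  rewrite cat_uniq undup_uniq filter_uniq // andbT /=.
  by apply/hasPn => x; rewrite mem_filter mem_undup => /andP[].
rewrite !(mem_cat, mem_undup, mem_filter) => /orP[-> //|/andP[_ /vV ->]].
by rewrite orbT.
Qed.

(** [p], the part of [q] outside [p], and [r] are disjoint. Each of them
    contributes at most [e] colors that are already in [U]. *)
Lemma gain_wide U p q r e : uniq p -> uniq q -> uniq r ->
  {in p, forall x, x \notin r} -> {in q, forall x, x \notin r} ->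
  count (mem U) p <= e -> count (mem U) q <= e -> count (mem U) r <= e ->
  num_colors U + (size p + size q + size r) <=
    num_colors (U ++ p ++ q ++ r) + count (mem p) q + 3 * e.
Proof.
move=> up uq ur pr qr Up Uq Ur.
set q' := [seq x <- q | x \notin p].
have Uq' : count (mem U) q' <= e.
  by apply: leq_trans Uq; rewrite count_filter; apply: sub_count => x /andP[].
have := @num_colors_new U (p ++ q ++ r) (p ++ q' ++ r) (e + (e + e)).
rewrite !cat_uniq !count_cat !size_cat size_filter up ur filter_uniq //=.
set k := count _ q => H; have kl : count (mem p) q + k = size q by exact: count_predC.
  set l := count _ q in kl *.
suff: num_colors U + (size p + (k + size r)) <=
  num_colors (U ++ p ++ q ++ r) + (e + (e + e)) by lia.
apply: H; last by rewrite !leq_add.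
  rewrite has_cat negb_or andbT -andbA; apply/and3P; split; apply/hasPn => x.
  - by rewrite mem_filter => /andP[].
  - by apply: contraTN => /pr.
  by apply: contraTN; rewrite mem_filter => /andP[_ /qr].
move=> x; rewrite !mem_cat mem_filter.
by case/or3P => [->|/andP[_ ->]|->]; rewrite ?orbT.
Qed.

(** The common part of [p] and [q] is disjoint from [r] because of [p] and from
    [v] because of [q]. The rest of [p] may recur in [v], and the rest of [q] in [r],
    which is why only the common part is counted. *)
Lemma gain_narrow U p q r v e : uniq q -> uniq r -> uniq v ->
  {in p, forall x, x \notin r} -> {in q, forall x, x \notin v} ->
  {in r, forall x, x \notin v} ->
  count (mem U) q <= e -> count (mem U) r <= e -> count (mem U) v <= e ->
  num_colors U + (count (mem p) q + size r + size v) <=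
    num_colors (U ++ p ++ q ++ r ++ v) + 3 * e.
Proof.
move=> uq ur uv pr qv rv Uq Ur Uv.
set q' := [seq x <- q | x \in p].
have Uq' : count (mem U) q' <= e.
  by apply: leq_trans Uq; rewrite count_filter; apply: sub_count => x /andP[].
have := @num_colors_new U (p ++ q ++ r ++ v) (q' ++ r ++ v) (e + (e + e)).
rewrite !cat_uniq !count_cat !size_cat size_filter ur uv filter_uniq //=.
set l := count _ q.
move=> H; suff: num_colors U + (l + (size r + size v)) <=
  num_colors (U ++ p ++ q ++ r ++ v) + (e + (e + e)) by lia.
apply: H; last by rewrite !leq_add.
  rewrite has_cat negb_or andbT -andbA; apply/and3P; split; apply/hasPn => x.
  - by apply: contraTN; rewrite mem_filter => /andP[/pr].
  - by apply: contraTN; rewrite mem_filter => /andP[_ /qv].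
  by apply: contraTN => /rv.
move=> x; rewrite !mem_cat mem_filter.
by case/or3P => [/andP[-> _]|->|->]; rewrite ?orbT.
Qed.

End Counting.

(** * Colored sequences of intervals *)

Section Colored.
Variable R : realType.
Implicit Types (I J : R * R) (u v : R * R * nat) (s t : seq (R * R)).
Implicit Types z : seq (R * R * nat).

Definition meets I J := (I.1 <= J.2) && (J.1 <= I.2).

(** The same condition serves for the answers of the algorithm and for offline
    colorings; being boolean and about pairs, it splits along concatenations. *)
Definition compatible u v := meets u.1 v.1 ==> (u.2 != v.2).

Lemma intersecting_meets I J : intersecting I J -> meets I J.
Proof.
case=> x [/=]; rewrite !in_itv /= => /andP[a b] /andP[c d].
by rewrite /meets (le_trans a d) (le_trans c b).
Qed.

Lemma meets_intersecting I J : I.1 <= I.2 -> J.1 <= J.2 -> meets I J ->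
  intersecting I J.
Proof.
move=> hI hJ /andP[IJ JI]; exists (Num.max I.1 J.1); split => /=;
  rewrite in_itv /= le_max ge_max lexx ?orbT /=; exact/andP.
Qed.

Lemma sigma_input_cat (sigma : R) s t : sigma_input sigma s ->
  sigma_input sigma t -> sigma_input sigma (s ++ t).
Proof. by move=> hs ht I; rewrite mem_cat => /orP[/hs|/ht]. Qed.

Lemma disjoint_colors z1 z2 : allrel compatible z1 z2 ->
  allrel meets (unzip1 z1) (unzip1 z2) ->
  {in unzip2 z1, forall x, x \notin unzip2 z2}.
Proof.
move=> /allrelP hc /allrelP hm _ /mapP[u uz1 ->]; apply/negP => /mapP[v vz2 uv].
have := hc _ _ uz1 vz2; rewrite /compatible uv eqxx hm //; exact: map_f.
Qed.

Lemma uniq_colors z : pairwise compatible z -> all2rel meets (unzip1 z) ->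
  uniq (unzip2 z).
Proof.
move=> hc /allrelP hm; rewrite uniq_pairwise pairwise_map.
apply: (sub_in_pairwise (P := [in z])) hc; last exact/allP.
by move=> u v uz vz; rewrite /compatible hm //; exact: map_f.
Qed.

(** * The coloring of the algorithm *)

(** Indexing the answers by an arbitrary history [s] lets the plays of the
    adversary be composed one after another. *)
Fixpoint transcript (A : strategy R) s t : seq (R * R * nat) :=
  if t is J :: t' then (J, A s J) :: transcript A (rcons s J) t' else [::].

Definition answers A s t := unzip2 (transcript A s t).

Lemma unzip1_transcript A s t : unzip1 (transcript A s t) = t.
Proof. by elim: t s => //= I t IH s; rewrite IH. Qed.

Lemma size_answers A s t : size (answers A s t) = size t.
Proof. by rewrite -[in RHS](unzip1_transcript A s t) !size_map. Qed.

Lemma transcript_cat A s t1 t2 :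
  transcript A s (t1 ++ t2) = transcript A s t1 ++ transcript A (s ++ t1) t2.
Proof.
by elim: t1 s => /= [|I t1 IH] s; rewrite ?cats0 // IH cat_rcons.
Qed.

Lemma answers_cat A s t1 t2 :
  answers A s (t1 ++ t2) = answers A s t1 ++ answers A (s ++ t1) t2.
Proof. by rewrite /answers transcript_cat /unzip2 map_cat. Qed.

Lemma run_answers A t : run A t = answers A [::] t.
Proof.
suff: forall s, mkseq (fun i => A (s ++ take i t) (nth (0, 0) t i)) (size t) =
  answers A s t by move/(_ [::]).
elim: t => //= I t IH s; rewrite /answers /mkseq /= cats0 -[unzip2 _]/(answers _ _ _) -IH.
congr cons; rewrite -[in LHS](addn0 1%N) iotaDl -map_comp; apply: eq_map => i /=.
by rewrite cat_rcons.
Qed.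

Lemma transcript_compatible (sigma : R) A s t : online_algorithm sigma A ->
  sigma_input sigma (s ++ t) -> pairwise compatible (transcript A s t).
Proof.
move=> hA hst; have [_ hP] := hA _ hst.
suff: pairwise compatible (transcript A [::] (s ++ t)).
  by rewrite transcript_cat pairwise_cat => /and3P[].
set w := s ++ t in hst hP *; rewrite run_answers in hP.
have sz : size (transcript A [::] w) = size w by rewrite -(size_map snd) size_answers.
apply/(pairwiseP ((0, 0), 0%N)) => i j; rewrite !inE sz => iw jw ij.
apply/implyP => /meets_intersecting hm; apply/eqP => eij.
apply: (hP i j) => //; first by move=> /eqP; rewrite ltn_eqF.
  have nthI k : (k < size w)%N ->
      (nth ((0, 0), 0%N) (transcript A [::] w) k).1 = nth (0, 0) w k.
    by move=> kw; rewrite -[in RHS](unzip1_transcript A [::] w) (nth_map ((0,0),0%N)) ?sz.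
  have le12 k : (k < size w)%N -> (nth (0, 0) w k).1 <= (nth (0, 0) w k).2.
    by move=> kw; have /andP[] := hst _ (mem_nth (0, 0) kw); lra.
  by move: hm; rewrite !nthI //; apply; apply: le12.
by rewrite !(nth_map ((0,0),0%N)) ?sz.
Qed.

(** * Offline colorings *)

(** An offline coloring with its spatial and color ranges. Two such pieces are
    compatible as soon as one of the two kinds of ranges is disjoint, so pieces
    can be assembled by looking at their ranges only. *)
Definition packed (a b : R) (lo hi : nat) z :=
  all (fun u => [&& a <= u.1.1, u.1.1 + 1 <= u.1.2, u.1.2 <= b &
                    (lo <= u.2 < hi)%N]) z && pairwise compatible z.

Lemma packed_sub a b a' b' lo hi lo' hi' z : packed a b lo hi z ->
  a' <= a -> b <= b' -> (lo' <= lo)%N -> (hi <= hi')%N -> packed a' b' lo' hi' z.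
Proof.
move=> /andP[hz pz] ha hb hlo hhi; rewrite /packed pz andbT.
apply: sub_all hz => u /and4P[h1 h2 h3 /andP[h4 h5]]; apply/and4P; split.
- exact: le_trans h1.
- by [].
- exact: le_trans hb.
by rewrite (leq_trans hlo h4) (leq_trans h5 hhi).
Qed.

Lemma packed_cat a b lo hi z1 z2 : packed a b lo hi z1 -> packed a b lo hi z2 ->
  allrel compatible z1 z2 -> packed a b lo hi (z1 ++ z2).
Proof.
move=> /andP[h1 p1] /andP[h2 p2] h12.
by rewrite /packed all_cat h1 h2 pairwise_cat h12 p1 p2.
Qed.

Lemma packed_apart a1 b1 lo1 hi1 z1 a2 b2 lo2 hi2 z2 :
  packed a1 b1 lo1 hi1 z1 -> packed a2 b2 lo2 hi2 z2 ->
  [|| b1 < a2, b2 < a1, (hi1 <= lo2)%N | (hi2 <= lo1)%N] ->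
  allrel compatible z1 z2.
Proof.
move=> /andP[/allP h1 _] /andP[/allP h2 _] h; apply/allrelP => u v /h1 hu /h2 hv.
case/and4P: hu => u1 u2 u3 /andP[u4 u5]; case/and4P: hv => v1 v2 v3 /andP[v4 v5].
apply/implyP => /andP[m1 m2]; case/or4P: h => h; try (exfalso; lra); apply/eqP; lia.
Qed.

Lemma packed_input (sigma : R) a b lo hi z : packed a b lo hi z -> b - a <= sigma ->
  sigma_input sigma (unzip1 z).
Proof.
move=> /andP[/allP hz _] hab _ /mapP[u /hz /and4P[h1 h2 h3 _] ->]; apply/andP; split; lra.
Qed.

Lemma packed_colorable a b m z : packed a b 0 m z -> colorable m (unzip1 z).
Proof.
move=> /andP[/allP hz pz]; exists (unzip2 z); split; last first.
  rewrite -(size_iota 0 m); apply: uniq_leq_size (undup_uniq _) _ => c.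
  by rewrite mem_undup mem_iota => /mapP[u /hz /and4P[_ _ _ h] ->].
have key i j : (i < j < size z)%N -> meets (nth (0, 0) (unzip1 z) i) (nth (0, 0) (unzip1 z) j) ->
    nth 0%N (unzip2 z) i <> nth 0%N (unzip2 z) j.
  case/andP=> ij jz; have iz := ltn_trans ij jz; rewrite !(nth_map ((0,0),0%N)) // => hm.
  have := pairwiseP ((0,0),0%N) pz i j iz jz ij; rewrite /compatible hm => /eqP.
  exact.
split; first by rewrite !size_map.
move=> i j; rewrite size_map => iz jz /eqP; rewrite neq_ltn.
case/orP => h /intersecting_meets hm; first by apply: key; rewrite ?h.
by apply: nesym; apply: key; rewrite ?h // /meets andbC.
Qed.

Definition recolor k z := [seq (u.1, (u.2 + k)%N) | u <- z].

Lemma unzip1_recolor k z : unzip1 (recolor k z) = unzip1 z.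
Proof. by rewrite /unzip1 -map_comp. Qed.

Lemma packed_recolor a b lo hi k z : packed a b lo hi z ->
  packed a b (lo + k) (hi + k) (recolor k z).
Proof.
move=> /andP[hz pz]; apply/andP; split.
  by rewrite all_map; apply: sub_all hz => u /=; rewrite leq_add2r ltn_add2r.
by rewrite pairwise_map; apply: sub_pairwise pz => u v; rewrite /compatible /= eqn_add2r.
Qed.

Definition stack I lo d : seq (R * R * nat) := [seq (I, c) | c <- iota lo d].

Lemma unzip1_stack I lo d : unzip1 (stack I lo d) = nseq d I.
Proof.
rewrite /unzip1 -map_comp; elim: d lo => //= d IH lo; congr cons; exact: IH.
Qed.

Lemma packed_stack I lo d : I.1 + 1 <= I.2 -> packed I.1 I.2 lo (lo + d) (stack I lo d).
Proof.
move=> hI; apply/andP; split.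
  by apply/allP => _ /mapP[c + ->]; rewrite mem_iota /= => ->; rewrite !lexx hI.
rewrite pairwise_map; apply: sub_pairwise (_ : pairwise (fun x y => x != y) _).
  by move=> x y /= xy; rewrite /compatible xy implybT.
by rewrite -uniq_pairwise iota_uniq.
Qed.

Lemma meets_stack a b lo hi z d I : packed a b lo hi z -> I.1 <= a -> b <= I.2 ->
  allrel meets (unzip1 z) (nseq d I).
Proof.
move=> /andP[/allP hz _] h1 h2; apply/allrelP => _ J /mapP[u /hz /and4P[k1 k2 k3 _] ->].
rewrite mem_nseq => /andP[_ /eqP ->]; apply/andP; split; lra.
Qed.

Lemma meets_stacks d d' I J : meets I J -> allrel meets (nseq d I) (nseq d' J).
Proof.
by move=> IJ; apply/allrelP => _ _ /nseqP[-> _] /nseqP[-> _].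
Qed.

End Colored.

(** * The step of the adversary *)

Section Adversary.
Variable R : realType.
Implicit Types (I J : R * R) (s t h : seq (R * R)) (z : seq (R * R * nat)).
Implicit Types (A : strategy R) (sigma W : R).

Lemma sigma_input_nseq sigma s d I : sigma_input sigma s ->
  1 <= I.2 - I.1 <= sigma -> sigma_input sigma (s ++ nseq d I).
Proof. by move=> hs hI; apply: sigma_input_cat hs _ => J /nseqP[-> _]. Qed.

Lemma answers_disjoint sigma A h t1 t2 t3 h' : online_algorithm sigma A ->
  h' = h ++ t1 ++ t2 -> sigma_input sigma (h' ++ t3) -> allrel (@meets R) t1 t3 ->
  {in answers A h t1, forall x, x \notin answers A h' t3}.
Proof.
move=> hA -> hs hm; apply: disjoint_colors; last by rewrite !unzip1_transcript.
have : pairwise (@compatible R) (transcript A h (t1 ++ t2 ++ t3)).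
  by apply: transcript_compatible hA _; move: hs; rewrite -!catA.
rewrite !transcript_cat pairwise_cat allrel_catr -!catA.
by case/and3P => /andP[].
Qed.

Lemma answers_uniq sigma A h d I : online_algorithm sigma A -> I.1 <= I.2 ->
  sigma_input sigma (h ++ nseq d I) -> uniq (answers A h (nseq d I)).
Proof.
move=> hA hI hs; apply: uniq_colors; first exact: transcript_compatible hA hs.
by rewrite unzip1_transcript; apply: meets_stacks; rewrite /meets hI.
Qed.

Lemma unzip1_cat z1 z2 : unzip1 (z1 ++ z2) = unzip1 z1 ++ unzip1 z2.
Proof. exact: map_cat. Qed.

(** The first alternative is the state from which the adversary goes on, the
    second one the goal of the current stage. The claim is for every history and
    every position, because the strategy is replayed in many places. *)
Definition forces sigma A W (m c m' c' : nat) :=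
  forall s (a : R), sigma_input sigma s -> exists z,
    packed a (a + W) 0 m z /\ (c <= num_colors (answers A s (unzip1 z)))%N \/
    packed a (a + W) 0 m' z /\ (c' <= num_colors (answers A s (unzip1 z)))%N.

(** An interval that covers a cell avoids the colors of the play [z] made there,
    whatever [t] came in between. So it brings few colors of any set [U] which
    that play nearly exhausts. *)
Lemma cover_copy sigma A h z t h' I (U : seq nat) c e d lo hi : online_algorithm sigma A ->
  packed I.1 I.2 lo hi z -> {subset answers A h (unzip1 z) <= U} ->
  (c <= num_colors (answers A h (unzip1 z)))%N -> (num_colors U < c + e)%N ->
  1 <= I.2 - I.1 <= sigma -> h' = h ++ unzip1 z ++ t -> sigma_input sigma h' ->
  [/\ sigma_input sigma (h' ++ nseq d I), uniq (answers A h' (nseq d I)),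
      size (answers A h' (nseq d I)) = d &
      (count (mem U) (answers A h' (nseq d I)) <= e)%N].
Proof.
move=> hA hz AU cA Uc lenI h'E hh'.
have hI := @sigma_input_nseq sigma h' d I hh' lenI.
have uI : uniq (answers A h' (nseq d I)) by apply: answers_uniq hA _ hI; lra.
split=> //; first by rewrite size_answers size_nseq.
apply: count_avoiding AU cA (ltnW Uc) uI _.
by apply: answers_disjoint hA h'E hI _; apply: meets_stack hz _ _.
Qed.

(* The tactic compares all pairs of blocks, first by color range, then by
   position. The arithmetic facts [hn] (on numbers of colors) and [hr] (on the
   geometry) are named so that everything else can be cleared beforehand:
   otherwise the decision procedures also process the hypotheses on blocks. *)
Local Ltac pack_blocks hn hr :=
  match goal with
  | |- is_true (packed _ _ _ _ (_ ++ _)) => apply: packed_cat; pack_blocks hn hr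
  | h : is_true (packed _ _ _ _ ?z) |- is_true (packed _ _ _ _ ?z) =>
      apply: (packed_sub h); (lazymatch goal with
        | |- is_true (leq _ _) => clear -hn; lia | _ => clear -hr; lra end)
  | |- is_true (allrel _ _ (_ ++ _)) =>
      rewrite allrel_catr; apply/andP; split; pack_blocks hn hr
  | h1 : is_true (packed _ _ _ _ ?z1), h2 : is_true (packed _ _ _ _ ?z2)
      |- is_true (allrel _ ?z1 ?z2) =>
      apply: (packed_apart h1 h2); apply/or4P;
      first [ apply: Or43; clear -hn; lia | apply: Or44; clear -hn; lia
            | apply: Or41; clear -hr; lra | apply: Or42; clear -hr; lra]
  end.

(** A cell of width [L = W + 2] holds a window of width [W] in its interior. The
    plays in the cells covered by an interval with the [d] lowest colors are
    recolored by [d], so that they use the [m] highest ones; the other plays keep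
    the [m] lowest ones and are covered with the [d] highest ones. The last
    interval meets both others, so it alone uses the low colors; it is disjoint
    from them because [d <= m]. *)
Lemma packed_wide (a W L : R) m d z1 z2 z3 z4 : 0 <= W /\ L = W + 2 -> (d <= m)%N ->
  packed (a + 1) (a + 1 + W) 0 m z1 ->
  packed (a + L + 1) (a + L + 1 + W) 0 m z2 ->
  packed (a + 2 * L + 1) (a + 2 * L + 1 + W) 0 m z3 ->
  packed (a + 3 * L + 1) (a + 3 * L + 1 + W) 0 m z4 ->
  packed a (a + 4 * L) 0 (m + d)
    (z1 ++ recolor d z2 ++ recolor d z3 ++ z4 ++
     stack (a, a + L) m d ++ stack (a + 3 * L, a + 4 * L) m d ++
     stack (a + L, a + 3 * L) 0 d).
Proof.
move=> WL dm p1 p2 p3 p4.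
have q2 := packed_recolor d p2; have q3 := packed_recolor d p3.
have [W_ge0 LE] := WL.
have stackP (x y : R) n : x + 1 <= y -> packed x y n (n + d) (stack (x, y) n d).
  exact: (@packed_stack R (x, y) n d).
have kP := stackP a (a + L) m ltac:(lra).
have kQ := stackP (a + 3 * L) (a + 4 * L) m ltac:(lra).
have kR := stackP (a + L) (a + 3 * L) 0%N ltac:(lra).
clear p2 p3; pack_blocks dm WL.
Qed.

(** From left to right, the covering intervals use high, low, high and low
    colors: each meets only its neighbors. *)
Lemma packed_narrow (a W L : R) m d z1 z2 z3 z4 : 0 <= W /\ L = W + 2 -> (d <= m)%N ->
  packed (a + 1) (a + 1 + W) 0 m z1 ->
  packed (a + L + 1) (a + L + 1 + W) 0 m z2 ->
  packed (a + 2 * L + 1) (a + 2 * L + 1 + W) 0 m z3 ->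
  packed (a + 3 * L + 1) (a + 3 * L + 1 + W) 0 m z4 ->
  packed a (a + 4 * L) 0 (m + d)
    (z1 ++ recolor d z2 ++ z3 ++ recolor d z4 ++
     stack (a, a + L) m d ++ stack (a + 3 * L, a + 4 * L) 0 d ++
     stack (a + L, a + 2 * L) 0 d ++ stack (a + 2 * L, a + 3 * L) m d).
Proof.
move=> WL dm p1 p2 p3 p4.
have q2 := packed_recolor d p2; have q4 := packed_recolor d p4.
have [W_ge0 LE] := WL.
have stackP (x y : R) n : x + 1 <= y -> packed x y n (n + d) (stack (x, y) n d).
  exact: (@packed_stack R (x, y) n d).
have kP := stackP a (a + L) m ltac:(lra).
have kQ := stackP (a + 3 * L) (a + 4 * L) 0%N ltac:(lra).
have kR := stackP (a + L) (a + 2 * L) 0%N ltac:(lra).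
have kS := stackP (a + 2 * L) (a + 3 * L) m ltac:(lra).
clear p2 p4; pack_blocks dm WL.
Qed.

(** The case in which the four color sets nearly coincide. Half of [5 * d] is the
    worst value of the larger one of 3d - x and 2d + x; the term [3 * e] pays for
    the colors that the covering intervals may share with the union. *)
Lemma over_close_copies sigma A W (m d e T c : nat) s (a : R) z1 z2 z3 z4 :
  online_algorithm sigma A -> sigma_input sigma s ->
  0 <= W -> 4 * W + 8 <= sigma -> (d <= m)%N -> (2 * (T + 3 * e) <= 5 * d)%N ->
  let L := W + 2 in
  packed (a + 1) (a + 1 + W) 0 m z1 ->
  packed (a + L + 1) (a + L + 1 + W) 0 m z2 ->
  packed (a + 2 * L + 1) (a + 2 * L + 1 + W) 0 m z3 ->
  packed (a + 3 * L + 1) (a + 3 * L + 1 + W) 0 m z4 ->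
  (c <= num_colors (answers A s (unzip1 z1)))%N ->
  (c <= num_colors (answers A (s ++ unzip1 z1) (unzip1 z2)))%N ->
  (c <= num_colors (answers A (s ++ unzip1 (z1 ++ z2)) (unzip1 z3)))%N ->
  (c <= num_colors (answers A (s ++ unzip1 (z1 ++ z2 ++ z3)) (unzip1 z4)))%N ->
  (num_colors (answers A s (unzip1 (z1 ++ z2 ++ z3 ++ z4))) < c + e)%N ->
  exists z, packed a (a + 4 * L) 0 (m + d) z /\
    (c + T <= num_colors (answers A s (unzip1 z)))%N.
Proof.
move=> hA hs W0 Ws dm Te L p1 p2 p3 p4 c1 c2 c3 c4.
set U := answers A s _ => small.
have UE : U = answers A s (unzip1 z1) ++ answers A (s ++ unzip1 z1) (unzip1 z2) ++
    answers A (s ++ unzip1 (z1 ++ z2)) (unzip1 z3) ++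
    answers A (s ++ unzip1 (z1 ++ z2 ++ z3)) (unzip1 z4).
  by rewrite /U !unzip1_cat !answers_cat !catA.
have cU : (c <= num_colors U)%N.
  by apply: leq_trans c1 (num_colors_sub _) => x; rewrite UE !mem_cat => ->.
have WL : 0 <= W /\ L = W + 2 by [].
have [_ LW] := WL; clearbody L U.
set h1 := s ++ unzip1 z1 in UE c2; set h2 := s ++ _ in UE c3.
set h3 := s ++ _ in UE c4; pose h4 := s ++ unzip1 (z1 ++ z2 ++ z3 ++ z4).
have hh4 : sigma_input sigma h4.
  rewrite /h4 !unzip1_cat; do !apply: sigma_input_cat => //.
  - by apply: packed_input p1 _; lra.
  - by apply: packed_input p2 _; lra.
  - by apply: packed_input p3 _; lra.
  by apply: packed_input p4 _; lra.
have AU1 : {subset answers A s (unzip1 z1) <= U}.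
  by move=> x; rewrite UE !mem_cat => ->.
have AU2 : {subset answers A h1 (unzip1 z2) <= U}.
  by move=> x; rewrite UE !mem_cat => ->; rewrite orbT.
have AU3 : {subset answers A h2 (unzip1 z3) <= U}.
  by move=> x; rewrite UE !mem_cat => ->; rewrite !orbT.
have AU4 : {subset answers A h3 (unzip1 z4) <= U}.
  by move=> x; rewrite UE !mem_cat => ->; rewrite !orbT.
pose P : R * R := (a, a + L); pose Q : R * R := (a + 3 * L, a + 4 * L).
pose h5 := h4 ++ nseq d P; pose h6 := h5 ++ nseq d Q.
have w1 : packed P.1 P.2 0 m z1 by apply: packed_sub p1 _ _ _ _ => //=; lra.
have [hh5 up sp Up] : [/\ _, _, _ & _] :=
  cover_copy (h' := h4) (t := unzip1 (z2 ++ z3 ++ z4)) d hA w1 AU1 c1 small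
    ltac:(rewrite /=; lra) ltac:(by rewrite /h4 !unzip1_cat) hh4.
have w4 : packed Q.1 Q.2 0 m z4 by apply: packed_sub p4 _ _ _ _ => //=; lra.
have [hh6 uq sq Uq] : [/\ _, _, _ & _] :=
  cover_copy (h' := h5) (t := nseq d P) d hA w4 AU4 c4 small
    ltac:(rewrite /=; lra) ltac:(by rewrite /h5 /h4 /h3 !unzip1_cat !catA) hh5.
set p := answers A h4 (nseq d P) in up sp Up; set q := answers A _ (nseq d Q) in uq sq Uq.
have [wide|narrow] := leqP (2 * count (mem p) q) d.
  pose Z : R * R := (a + L, a + 3 * L).
  have w2 : packed Z.1 Z.2 0 m z2 by apply: packed_sub p2 _ _ _ _ => //=; lra.
  have [hh7 ur sr Ur] : [/\ _, _, _ & _] :=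
    cover_copy (h' := h6) (t := unzip1 (z3 ++ z4) ++ nseq d P ++ nseq d Q) d hA w2 AU2
      c2 small ltac:(rewrite /=; lra)
      ltac:(by rewrite /h6 /h5 /h4 /h1 !unzip1_cat !catA) hh6.
  set r := answers A _ (nseq d Z) in ur sr Ur.
  have pr : {in p, forall x, x \notin r}.
    apply: (answers_disjoint (t2 := nseq d Q)) hA _ hh7 _; first by rewrite /h6 /h5 !catA.
    by apply: meets_stacks; rewrite /meets /=; lra.
  have qr : {in q, forall x, x \notin r}.
    apply: (answers_disjoint (t2 := [::])) hA _ hh7 _; first by rewrite /h6 cats0.
    by apply: meets_stacks; rewrite /meets /=; lra.
  have gain := gain_wide up uq ur pr qr Up Uq Ur.
  have := packed_wide WL dm p1 p2 p3 p4; set z := (X in packed _ _ _ _ X) => hz.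
  exists z; split=> //.
  suff -> : answers A s (unzip1 z) = U ++ p ++ q ++ r.
    by move: gain; rewrite sp sq sr; move: Te cU wide; clear; lia.
  rewrite UE /r /q /p /h6 /h5 /h4 /h3 /h2 /h1 /z !unzip1_cat !unzip1_recolor !unzip1_stack.
  by rewrite !answers_cat !catA.
pose Y : R * R := (a + L, a + 2 * L); pose Z : R * R := (a + 2 * L, a + 3 * L).
have w2 : packed Y.1 Y.2 0 m z2 by apply: packed_sub p2 _ _ _ _ => //=; lra.
have w3 : packed Z.1 Z.2 0 m z3 by apply: packed_sub p3 _ _ _ _ => //=; lra.
pose h7 := h6 ++ nseq d Y.
have [hh7 ur sr Ur] : [/\ _, _, _ & _] :=
  cover_copy (h' := h6) (t := unzip1 (z3 ++ z4) ++ nseq d P ++ nseq d Q) d hA w2 AU2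
    c2 small ltac:(rewrite /=; lra)
    ltac:(by rewrite /h6 /h5 /h4 /h1 !unzip1_cat !catA) hh6.
have [hh8 uv sv Uv] : [/\ _, _, _ & _] :=
  cover_copy (h' := h7) (t := unzip1 z4 ++ nseq d P ++ nseq d Q ++ nseq d Y) d hA w3 AU3
    c3 small ltac:(rewrite /=; lra)
    ltac:(by rewrite /h7 /h6 /h5 /h4 /h2 !unzip1_cat !catA) hh7.
set r := answers A _ (nseq d Y) in ur sr Ur; set v := answers A _ (nseq d Z) in uv sv Uv.
have pr : {in p, forall x, x \notin r}.
  apply: (answers_disjoint (t2 := nseq d Q)) hA _ hh7 _; first by rewrite /h6 /h5 !catA.
  by apply: meets_stacks; rewrite /meets /=; lra.
have qv : {in q, forall x, x \notin v}.
  apply: (answers_disjoint (t2 := nseq d Y)) hA _ hh8 _; first by rewrite /h7 /h6 !catA.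
  by apply: meets_stacks; rewrite /meets /=; lra.
have rv : {in r, forall x, x \notin v}.
  apply: (answers_disjoint (t2 := [::])) hA _ hh8 _; first by rewrite /h7 cats0.
  by apply: meets_stacks; rewrite /meets /=; lra.
have gain := gain_narrow uq ur uv pr qv rv Uq Ur Uv.
have := packed_narrow WL dm p1 p2 p3 p4; set z := (X in packed _ _ _ _ X) => hz.
exists z; split=> //.
suff -> : answers A s (unzip1 z) = U ++ p ++ q ++ r ++ v.
  by move: gain; rewrite sr sv; move: Te cU narrow; clear; lia.
rewrite UE /v /r /q /p /h7 /h6 /h5 /h4 /h3 /h2 /h1 /z !unzip1_cat !unzip1_recolor !unzip1_stack.
by rewrite !answers_cat !catA.
Qed.

(** Either the four plays together have [e] colors more than each of them must
    have, or [over_close_copies] applies. A play that already reaches the goal of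
    the stage ends the whole round; what was presented before it in the round
    stays to its left. *)
Lemma forces_level sigma A W (m d e T c c' : nat) : online_algorithm sigma A ->
  0 <= W -> 4 * W + 8 <= sigma -> (d <= m)%N -> (2 * (T + 3 * e) <= 5 * d)%N ->
  (c' <= c + T)%N ->
  forces sigma A W m c (m + d) c' ->
  forces sigma A (4 * W + 8) m (c + e) (m + d) c'.
Proof.
move=> hA W0 Ws dm Te c'c H s a hs.
pose L := W + 2; have LW : L = W + 2 by []; have -> : 4 * W + 8 = 4 * L by lra.
clearbody L; set b := a + 4 * L; have bE : b = a + 4 * L by [].
clearbody b.
have next z x a1 : packed a x 0 m z -> x < a1 -> a <= a1 -> a1 + W <= b ->
    (exists z', packed a b 0 (m + d) z' /\
       (c' <= num_colors (answers A s (unzip1 z')))%N) \/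
    exists z1, [/\ packed a1 (a1 + W) 0 m z1, packed a (a1 + W) 0 m (z ++ z1) &
       (c <= num_colors (answers A (s ++ unzip1 z) (unzip1 z1)))%N].
  move=> hz xa1 aa1 a1b.
  have hs' : sigma_input sigma (s ++ unzip1 z).
    by apply: sigma_input_cat hs _; apply: packed_input hz _; lra.
  have zz1 m' z1 : (m <= m')%N -> packed a1 (a1 + W) 0 m' z1 ->
      packed a (a1 + W) 0 m' (z ++ z1).
    move=> mm' hz1; apply: packed_cat (packed_apart hz hz1 _); last by rewrite xa1.
      by apply: packed_sub hz _ _ _ mm' => //; lra.
    exact: packed_sub hz1 _ _ _ _.
  have [z1 [[hz1 cz1]|[hz1 cz1]]] := H _ a1 hs'; [right|left].
    by exists z1; split=> //; apply: zz1.
  exists (z ++ z1); split.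
    by apply: packed_sub (zz1 _ _ _ hz1) _ _ _ _; rewrite ?leq_addr.
  apply: leq_trans cz1 _; rewrite unzip1_cat answers_cat; apply: num_colors_sub.
  by move=> x'; rewrite mem_cat => ->; rewrite orbT.
have [[z' hz']|[z1 []]] := next [::] a (a + 1) isT ltac:(lra) ltac:(lra) ltac:(lra).
  by exists z'; right.
rewrite cats0 cat0s => p1 q1 c1.
have [[z' hz']|[z2 [p2 q2 c2]]] :=
    next _ _ (a + L + 1) q1 ltac:(lra) ltac:(lra) ltac:(lra).
  by exists z'; right.
have [[z' hz']|[z3 [p3 q3 c3]]] :=
    next _ _ (a + 2 * L + 1) q2 ltac:(lra) ltac:(lra) ltac:(lra).
  by exists z'; right.
have [[z' hz']|[z4 [p4 q4 c4]]] :=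
    next _ _ (a + 3 * L + 1) q3 ltac:(lra) ltac:(lra) ltac:(lra).
  by exists z'; right.
rewrite -!catA in q4 c4.
have [big|small] := leqP (c + e) (num_colors (answers A s (unzip1 (z1 ++ z2 ++ z3 ++ z4)))).
  exists (z1 ++ z2 ++ z3 ++ z4); left; split=> //.
  by apply: packed_sub q4 _ _ _ _ => //; lra.
subst L b.
have [z [hz cz]] := over_close_copies hA hs W0 Ws dm Te p1 p2 p3 p4 c1 c2 c3 c4 small.
by exists z; right; split=> //; apply: leq_trans cz.
Qed.

End Adversary.

(** * Iteration and the competitive ratio *)

Section Iteration.
Variable R : realType.
Implicit Types (A : strategy R) (sigma W : R).

(** [4 * w + 8] is the total width of four cells of width [w + 2]. *)
Fixpoint width (j : nat) : R := if j is i.+1 then 4 * width i + 8 else 0.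

Lemma width_ge0 j : 0 <= width j.
Proof. by elim: j => //= j IH; lra. Qed.

Lemma width_le i j : (i <= j)%N -> width i <= width j.
Proof.
elim: j => [|j IH]; first by rewrite leqn0 => /eqP ->.
rewrite leq_eqVlt => /predU1P[-> //|]; rewrite ltnS => /IH ij.
by apply: le_trans ij _; rewrite /=; have := width_ge0 j; lra.
Qed.

Lemma forces_levels sigma A j k (m d e T c c' : nat) : online_algorithm sigma A ->
  width (j + k) <= sigma -> (d <= m)%N -> (2 * (T + 3 * e) <= 5 * d)%N ->
  (c' <= c + T)%N -> forces sigma A (width j) m c (m + d) c' ->
  forces sigma A (width (j + k)) m (c + k * e) (m + d) c'.
Proof.
move=> hA Wk dm Te c'c H; elim: k Wk => [|k IH] Wk; first by rewrite mul0n !addn0.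
have Wk' : width (j + k) <= sigma.
  by apply: le_trans Wk; apply: width_le; rewrite leq_add2l.
rewrite addnS mulSn (addnC e) addnA /=.
by apply: (forces_level hA (width_ge0 _) _ dm Te _ (IH Wk')); [rewrite addnS in Wk | lia].
Qed.

(** The offline price is [n.+1 * d] and not [n * d] because a step from [m] to
    [m + d] needs [d <= m]: one [d] is spent in advance, to no asymptotic
    effect. In each stage, [k] levels suffice for the first alternative of
    [forces] to provide the [T] new colors as well. *)
Lemma forces_stages sigma A n k (d e T : nat) : online_algorithm sigma A ->
  width (n * k) <= sigma -> (2 * (T + 3 * e) <= 5 * d)%N -> (T <= k * e)%N ->
  forces sigma A (width (n * k)) (n.+1 * d) (n * T) (n.+1 * d) (n * T).
Proof.
move=> hA Wk Te Tk; elim: n Wk => [|n IH] Wk s a hs.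
  by exists [::]; left; split.
rewrite (mulSnr n k) in Wk *; rewrite (mulSnr n T) (mulSnr n.+1 d).
have step : forces sigma A (width (n * k + k)) (n.+1 * d) (n * T + k * e)
    (n.+1 * d + d) (n * T + T).
  apply: (forces_levels hA Wk _ Te (leqnn _)); first by rewrite mulSn leq_addr.
  move=> s' a' hs'.
  have [|z hz] := IH _ s' a' hs'; last by exists z; left; case: hz.
  by apply: le_trans Wk; apply: width_le; rewrite leq_addr.
have [z [[hz cz]|hz]] := step s a hs; exists z; left; last by [].
split; first by apply: packed_sub hz _ _ _ _ => //; rewrite leq_addr.
by apply: leq_trans cz; rewrite leq_add2l.
Qed.

Lemma forced_input sigma A N u : online_algorithm sigma A ->
  (0 < N)%N -> width (N * (5 * N)) <= sigma ->
  exists s, [/\ sigma_input sigma s, colorable (N.+1 * (2 * N * u)) s &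
                (N * ((5 * N - 3) * u) <= num_colors (run A s))%N].
Proof.
move=> hA N0 Ws; have hN : sigma_input sigma ([::] : seq (R * R)) by [].
have h1 : (2 * ((5 * N - 3) * u + 3 * u) <= 5 * (2 * N * u))%N.
  by rewrite -mulnDl subnK; lia.
have h2 : ((5 * N - 3) * u <= 5 * N * u)%N by rewrite leq_mul2r leq_subr orbT.
have [z] := forces_stages hA Ws h1 h2 0 hN.
have -> (X Y : Prop) : X /\ Y \/ X /\ Y <-> X /\ Y by tauto.
case=> hz cz; exists (unzip1 z); split; last by rewrite run_answers.
  by apply: packed_input hz _; rewrite add0r subr0.
exact: packed_colorable hz.
Qed.

End Iteration.

Lemma limn_esup_ge (R : realType) (f : nat -> \bar R) (r : \bar R) :
  (forall n, exists2 k, (n <= k)%N & (r <= f k)%E) -> (r <= limn_esup f)%E.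
Proof.
move=> H; rewrite limn_esup_lim; apply: lime_ge; first exact: is_cvg_esups.
apply: nearW => n; have [k nk rk] := H n.
by apply: le_trans rk (ereal_sup_ubound _); exists k.
Qed.

(** The number [n.+1] plays the role of the scale factor: it makes the number of
    offline colors arbitrarily large while the ratio and the width stay fixed. *)
Lemma competitive_ge (R : realType) (sigma : R) A N (alpha : R) : (0 < N)%N ->
  width R (N * (5 * N)) <= sigma -> online_algorithm sigma A ->
  competitive sigma A alpha -> (5 * N - 3)%:R / (2 * N.+1)%:R <= alpha.
Proof.
move=> N0 Ws hA; rewrite -lee_fin; apply: le_trans; apply: limn_esup_ge => n.
exists (N.+1 * (2 * N * n.+1))%N; first by nia.
have [s [hs cs ns]] := forced_input n.+1 hA N0 Ws.
apply: (@le_trans _ _ ((N * ((5 * N - 3) * n.+1))%:R%:E *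
    (N.+1 * (2 * N * n.+1))%:R^-1%:E)%E).
  rewrite -EFinM lee_fin !natrM le_eqVlt; apply/orP; left; apply/eqP.
  have NN : N%:R != 0 :> R by rewrite pnatr_eq0 -lt0n.
  have nn : n.+1%:R != 0 :> R by rewrite pnatr_eq0.
  have N1 : N.+1%:R != 0 :> R by rewrite pnatr_eq0.
  by field; rewrite addrC natr1 nn NN addrC natr1 N1.
apply: lee_wpmul2r; first by rewrite lee_fin invr_ge0.
apply: le_trans (ereal_sup_ubound _); last by exists s.
by rewrite lee_fin ler_nat.
Qed.

Theorem theorem6 (R : realType) (eps : R) (eps_gt0 : 0 < eps) :
  exists sigma : R, 1 <= sigma /\
    ~ exists A : strategy R,
        online_algorithm sigma A /\ competitive sigma A (5%:R / 2%:R - eps).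
Proof.
(* The ratio [(5 * N - 3) / (2 * N.+1)] equals [5 / 2 - 4 / N.+1]. *)
pose N := (Num.truncn (4 / eps)).+1.
have Ngt : 4 / eps < N%:R by exact: truncnS_gt.
have N0 : (0 < N)%N by [].
exists (1 + width R (N * (5 * N))); split; first by have := width_ge0 R (N * (5 * N)); lra.
case=> A [hA hc].
have := competitive_ge N0 _ hA hc; rewrite ler_wpDl // => /(_ isT).
rewrite ler_pdivrMr ?ltr0n // natrB; last by lia.
rewrite ltr_pdivrMr // in Ngt; rewrite !natrM -natr1.
apply/negP; rewrite -ltNge; nra.
Qed.
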